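(* Let $f:\Omega\to\mathbb H^3_1$ be a timelike immersion of a domain $\Omega\subset\mathbb R^2$, with unit normal $N$, of constant Gaussian curvature $K$ whose mean curvature is not constant on any nonempty open set, and let $\theta\ne0$ be a real number with $K\sinh^2\theta\ne1$. Then the parallel surface $f^\theta=f\cosh\theta+N\sinh\theta$ does not have constant mean curvature on any nonempty open set on which it is an immersion. In particular, if $K\le0$, no parallel surface of $f$ has constant mean curvature on a (nonempty) open set.
   Context: Ambient space. On the space $\mathfrak{gl}(2,\mathbb R)$ of real $2\times2$ matrices let $\langle X,Y\rangle=-\tfrac12\operatorname{tr}(X\bar Y)$, where $\bar Y=(\operatorname{tr}Y)\mathrm{Id}-Y$; then $\langle X,X\rangle=-\det X$. Anti-de Sitter 3-space is $\mathbb H^3_1=\{X:\langle X,X\rangle=-1\}=SL(2,\mathbb R)$ with the induced Lorentzian metric. All maps are smooth; a domain is a connected open set. An immersion $f$ is timelike if the induced metric is Lorentzian. A unit normal is $N$ with $\langle N,N\rangle=1$ and $N$ orthogonal to $f,f_x,f_y$. The shape operator $S$ is defined by $S(f_x,f_y)^T=(N_x,N_y)^T$, and the Gaussian and mean curvatures are given by $K+1=\det S$, $H=-\tfrac12\operatorname{tr}S$. Where $f^\theta$ is an immersion (equivalently $\det(\mathrm{Id}\cosh\theta+S\sinh\theta)\ne0$), its mean curvature is taken with respect to the unit normal $N^\theta=N\cosh\theta+f\sinh\theta$. *)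

(* Defs.v *)
From HB Require Import structures.
From mathcomp Require Import all_boot all_order all_algebra.
From mathcomp Require Import all_classical all_reals all_analysis.
Set Implicit Arguments.
Unset Strict Implicit.
Unset Printing Implicit Defensive.
Import Order.TTheory GRing.Theory Num.Theory.
Import numFieldNormedType.Exports.
Local Open Scope classical_set_scope.
Local Open Scope ring_scope.

Definition cosh (R : realType) (x : R) : R := (expR x + expR (- x)) / 2.
Definition sinh (R : realType) (x : R) : R := (expR x - expR (- x)) / 2.

Fixpoint class_C (R : realType) (V W : normedModType R) (k : nat)
    (U : set V) (f : V -> W) : Prop :=
  if k is k'.+1 then
    (forall p, U p -> differentiable f p) /\
    (forall v : V, class_C k' U ('D_v f))
  else forall p, U p -> {for p, continuous f}.

Definition smooth_on (R : realType) (V W : normedModType R)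
    (U : set V) (f : V -> W) : Prop := forall k, class_C k U f.

Definition immersion_on (R : realType) (V W : normedModType R)
    (U : set V) (f : V -> W) : Prop :=
  forall p, U p -> differentiable f p /\ injective ('d f p).

Definition mxbar (R : realType) (Y : 'M[R]_2) : 'M[R]_2 := (\tr Y)%:M - Y.

Definition ads_form (R : realType) (X Y : 'M[R]_2) : R :=
  - (1 / 2) * \tr (X *m mxbar Y).

Definition H31 (R : realType) : set 'M[R]_2 := [set X | ads_form X X = -1].

(* 0 is the x-direction, 1 is the y-direction. *)
Definition partial (R : realType) (i : 'I_2) (f : 'rV[R]_2 -> 'M[R]_2) :
  'rV[R]_2 -> 'M[R]_2 := 'D_(delta_mx 0 i) f.

Definition induced_metric (R : realType) (f : 'rV[R]_2 -> 'M[R]_2)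
    (p v w : 'rV[R]_2) : R :=
  ads_form ('d f p v) ('d f p w).

(* Signature (1,1): an orthogonal basis with one positive and one negative
   vector. Such v and w are automatically linearly independent. *)
Definition lorentzian (R : realType) (g : 'rV[R]_2 -> 'rV[R]_2 -> R) : Prop :=
  exists v w, [/\ 0 < g v v, g w w < 0 & g v w = 0].

Definition timelike_immersion_on (R : realType) (U : set 'rV[R]_2)
    (f : 'rV[R]_2 -> 'M[R]_2) : Prop :=
  immersion_on U f /\ (forall p, U p -> lorentzian (induced_metric f p)).

Definition unit_normal_on (R : realType) (U : set 'rV[R]_2)
    (f N : 'rV[R]_2 -> 'M[R]_2) : Prop :=
  forall p, U p ->
    [/\ ads_form (N p) (N p) = 1, ads_form (N p) (f p) = 0
      & forall i, ads_form (N p) (partial i f p) = 0].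

(* S (f_x, f_y)^T = (N_x, N_y)^T *)
Definition is_shape_operator (R : realType) (f N : 'rV[R]_2 -> 'M[R]_2)
    (p : 'rV[R]_2) (S : 'M[R]_2) : Prop :=
  forall i, \sum_(j < 2) S i j *: partial j f p = partial i N p.

(* The default value 0 is irrelevant where f is an immersion into H31 with
   unit normal N: there exactly one matrix satisfies is_shape_operator. *)
Definition shape_operator (R : realType) (f N : 'rV[R]_2 -> 'M[R]_2)
    (p : 'rV[R]_2) : 'M[R]_2 :=
  xget 0 [set S | is_shape_operator f N p S].

(* K + 1 = det S *)
Definition gauss_curvature (R : realType) (f N : 'rV[R]_2 -> 'M[R]_2)
    (p : 'rV[R]_2) : R := \det (shape_operator f N p) - 1.

Definition mean_curvature (R : realType) (f N : 'rV[R]_2 -> 'M[R]_2)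
    (p : 'rV[R]_2) : R := - (1 / 2) * \tr (shape_operator f N p).

Definition constant_on (T S : Type) (U : set T) (g : T -> S) : Prop :=
  exists c, forall p, U p -> g p = c.

Definition parallel (R : realType) (f N : 'rV[R]_2 -> 'M[R]_2) (theta : R) :
    'rV[R]_2 -> 'M[R]_2 :=
  fun p => cosh theta *: f p + sinh theta *: N p.

Definition parallel_normal (R : realType) (f N : 'rV[R]_2 -> 'M[R]_2)
    (theta : R) : 'rV[R]_2 -> 'M[R]_2 :=
  fun p => cosh theta *: N p + sinh theta *: f p.

(* Main.v *)
(* Along the parallel surface the frame satisfies
     f^theta_i = sum_j (cosh Id + sinh S)_ij f_j,
     N^theta_i = sum_j (cosh S + sinh Id)_ij f_j,
   so S^theta = (cosh S + sinh Id) (cosh Id + sinh S)^-1, and tr S^theta is the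
   image of t = tr S under the Moebius transformation
     t |-> ((cosh^2 + sinh^2) t + 2 cosh sinh (K + 2))
           / (cosh sinh t + cosh^2 + (K + 1) sinh^2),
   whose determinant is 1 - K sinh^2. When this is nonzero the transformation
   is injective, hence t is constant as soon as tr S^theta is. *)
Require Import Defs.
From HB Require Import structures.
From mathcomp Require Import all_boot all_order all_algebra.
From mathcomp Require Import all_classical all_reals all_analysis.
From mathcomp Require Import ring.
Import Order.TTheory GRing.Theory Num.Theory.
Import numFieldNormedType.Exports.
Local Open Scope classical_set_scope.
Local Open Scope ring_scope.

(** * Algebra of 2 by 2 matrices and hyperbolic functions *)

Lemma det_mx22 (R : comNzRingType) (A : 'M[R]_2) :
  \det A = A 0 0 * A 1 1 - A 0 1 * A 1 0.
Proof.
rewrite (expand_det_row _ 0) !big_ord_recl big_ord0 /cofactor !det_mx11 !mxE /=.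
have -> : lift 0 0 = 1 :> 'I_2 by apply/val_inj.
have -> : lift 1 0 = 0 :> 'I_2 by apply/val_inj.
rewrite /bump /= expr0 expr1; ring.
Qed.

Lemma mxtrace2 (R : pzSemiRingType) (A : 'M[R]_2) : \tr A = A 0 0 + A 1 1.
Proof.
rewrite /mxtrace !big_ord_recl big_ord0 addr0.
by have -> : lift ord0 ord0 = 1 :> 'I_2 by apply/val_inj.
Qed.

Lemma sum_ord2 (V : nmodType) (F : 'I_2 -> V) : \sum_(i < 2) F i = F 0 + F 1.
Proof.
rewrite !big_ord_recl big_ord0 addr0.
by have -> : lift ord0 ord0 = 1 :> 'I_2 by apply/val_inj.
Qed.

(** Multiply the hypothesis on the right by the adjugate of [P = c%:M + s *: S] and take traces: the
    left side becomes [\tr T * \det P], with no division. *)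
Lemma trace_moebius (R : comNzRingType) (c s : R) (S T : 'M[R]_2) :
  T *m (c%:M + s *: S) = s%:M + c *: S ->
  \tr T * (c * s * \tr S + c ^+ 2 + s ^+ 2 * \det S) =
  (c ^+ 2 + s ^+ 2) * \tr S + 2 * c * s * (1 + \det S).
Proof.
move=> /matrixP TP.
have := TP 0 0; have := TP 0 1; have := TP 1 0; have := TP 1 1.
rewrite !mxE !sum_ord2 !mxE /= !mulr1n !mulr0n !mxtrace2 !det_mx22.
move: (S 0 0) (S 0 1) (S 1 0) (S 1 1) (T 0 0) (T 0 1) (T 1 0) (T 1 1).
move=> a b d e t u v w H11 H10 H01 H00.
(* This is [\tr (T *m P *m \adj P)] in entries, arranged so that the entries of [T *m P] occur
   literally and can be rewritten. *)
transitivity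
    ((t * (c + s * a) + u * (0 + s * d)) * (c + s * e)
     - (t * (0 + s * b) + u * (c + s * e)) * (s * d)
     + (v * (0 + s * b) + w * (c + s * e)) * (c + s * a)
     - (v * (c + s * a) + w * (0 + s * d)) * (s * b)); first by ring.
by rewrite H11 H10 H01 H00; ring.
Qed.

Lemma cosh_sqr (R : realType) (x : R) : cosh x ^+ 2 = 1 + sinh x ^+ 2.
Proof.
have e : expR x * expR (- x) = 1 :> R by rewrite -expRD subrr expR0.
rewrite /cosh /sinh; apply/eqP; rewrite -subr_eq; apply/eqP.
by rewrite -[RHS]e; field.
Qed.

(** * The bilinear form and its derivative *)

Lemma ads_formE (R : realType) (X Y : 'M[R]_2) : ads_form X Y =
  - (1 / 2) * (X 0 0 * Y 1 1 + X 1 1 * Y 0 0 - X 0 1 * Y 1 0 - X 1 0 * Y 0 1).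
Proof.
rewrite /ads_form /mxbar !mxtrace2 !mxE !sum_ord2 !mxE /=.
by rewrite !mulr1n !mulr0n; ring.
Qed.

Lemma ads_formC (R : realType) (X Y : 'M[R]_2) :
  ads_form X Y = ads_form Y X.
Proof. by rewrite !ads_formE; ring. Qed.

Lemma ads_formDr (R : realType) (X Y Z : 'M[R]_2) :
  ads_form X (Y + Z) = ads_form X Y + ads_form X Z.
Proof. by rewrite !ads_formE !mxE; ring. Qed.

Lemma ads_formZr (R : realType) (a : R) (X Y : 'M[R]_2) :
  ads_form X (a *: Y) = a * ads_form X Y.
Proof. by rewrite !ads_formE !mxE; ring. Qed.

Lemma derive_ads_form (R : realType) (V : normedModType R)
    (A B : V -> 'M[R]_2) (p v : V) :
  derivable A p v -> derivable B p v ->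
  'D_v (fun q => ads_form (A q) (B q)) p =
  ads_form ('D_v A p) (B p) + ads_form (A p) ('D_v B p).
Proof.
move=> dA dB; rewrite !ads_formE !derive_mx// !mxE.
have dAe i j : is_derive p v (fun q => A q i j) ('D_v (fun q => A q i j) p).
  by apply: derivableP; apply: (iffLR (derivable_mxP _ _ _)) dA i j.
have dBe i j : is_derive p v (fun q => B q i j) ('D_v (fun q => B q i j) p).
  by apply: derivableP; apply: (iffLR (derivable_mxP _ _ _)) dB i j.
under eq_fun do rewrite ads_formE.
have dM i j k l := is_deriveM (dAe i j) (dBe k l).
have H := is_deriveZ (- (1 / 2)) (is_deriveB (is_deriveB
  (is_deriveD (dM 0 0 1 1) (dM 1 1 0 0)) (dM 0 1 1 0)) (dM 1 0 0 1)).
rewrite -[LHS]/('D_v _ p) (@derive_val _ _ _ _ _ _ _ H).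
rewrite /GRing.scale /=; ring.
Qed.

(** On an open set the pairing agrees near [p] with a constant, so its Leibniz expansion vanishes.
    This serves to differentiate the relations for [<f,f>], [<N,N>] and [<N,f>]. *)
Lemma derive_ads_form_cst (R : realType) (V : normedModType R) (U : set V)
    (A B : V -> 'M[R]_2) (k : R) (p v : V) :
  open U -> U p -> (forall q, U q -> ads_form (A q) (B q) = k) ->
  derivable A p v -> derivable B p v ->
  ads_form ('D_v A p) (B p) + ads_form (A p) ('D_v B p) = 0.
Proof.
move=> oU Up UAB dA dB; rewrite -derive_ads_form//.
rewrite -[RHS](derive_cst k p v); apply: near_eq_derive.
by apply: filterS (open_nbhs_nbhs (conj oU Up)) => q /UAB.
Qed.

(* [F], [N], [X 0], [X 1] form a basis of the 4-dimensional space of matrices. *)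
Lemma orthogonal_complement_span (R : realType) (F N Y : 'M[R]_2)
    (X : 'I_2 -> 'M[R]_2) :
  ads_form F F = -1 -> ads_form N N = 1 -> ads_form N F = 0 ->
  (forall i, ads_form F (X i) = 0) -> (forall i, ads_form N (X i) = 0) ->
  (forall a : 'rV[R]_2, \sum_(i < 2) a 0 i *: X i = 0 -> a = 0) ->
  ads_form F Y = 0 -> ads_form N Y = 0 ->
  exists a : 'rV[R]_2, \sum_(i < 2) a 0 i *: X i = Y.
Proof.
move=> FF NN NF FX NX Xfree FY NY.
have FN : ads_form F N = 0 by rewrite ads_formC.
pose B := [tuple F; N; X 0; X 1].
have sumB (k : 'I_4 -> R) : \sum_(i < 4) k i *: B`_i =
    k (inord 0) *: F + (k (inord 1) *: N
      + (k (inord 2) *: X 0 + k (inord 3) *: X 1)).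
  rewrite !big_ord_recl big_ord0 addr0 /=.
  by do ![congr (_ + _)|congr (_ *: _)|congr k]; apply/val_inj;
    rewrite /= inordK.
(* Pairing with [F] and [N] isolates the first two coefficients; the sign comes from
   [<F,F> = -1]. *)
have coef (k : 'I_4 -> R) :
    ads_form F (\sum_(i < 4) k i *: B`_i) = - k (inord 0) /\
    ads_form N (\sum_(i < 4) k i *: B`_i) = k (inord 1).
  rewrite sumB !ads_formDr !ads_formZr FF NN NF FN !FX !NX; split; ring.
have Bfree : free B.
  apply/freeP => k k0.
  have [c0 c1] := coef k; move: c0 c1.
  rewrite k0 -(scale0r F) !ads_formZr !mul0r => /esym/eqP.
  rewrite oppr_eq0 => /eqP c0 /esym c1.
  move: k0; rewrite sumB c0 c1 !scale0r !add0r => k0.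
  have /rowP a0 : \row_i k (if i == 0 then inord 2 else inord 3) = 0 :> 'rV[R]_2.
    by apply: Xfree; rewrite sum_ord2 !mxE.
  have := a0 0; have := a0 1; rewrite !mxE /= => c3 c2 i.
  rewrite -[i]inord_val; case: i => -[|[|[|[|//]]]] ? //=.
(* Four free vectors span, by dimension count. *)
have Bspan : Y \in <<B>>%VS.
  suff /eqP -> : <<B>>%VS == fullv by rewrite memvf.
  by rewrite -(eq_leqif (dimv_leqif_eq (subvf _))) (eqnP Bfree) dimvf dim_matrix.
have YE := coord_span Bspan; have [] := coef (coord B ^~ Y).
rewrite -YE FY NY => /esym/eqP; rewrite oppr_eq0 => /eqP c0 /esym c1.
exists (\row_i coord B (if i == 0 then inord 2 else inord 3) Y).
by rewrite sum_ord2 !mxE /= [RHS]YE sumB c0 c1 !scale0r !add0r.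
Qed.

(** * Partial derivatives as a tangent frame *)

Lemma sum_partial (R : realType) (f : 'rV[R]_2 -> 'M[R]_2) (p a : 'rV[R]_2) :
  differentiable f p -> \sum_(i < 2) a 0 i *: partial i f p = 'd f p a.
Proof.
move=> df; rewrite [in RHS](row_sum_delta a) linear_sum /=.
by apply: eq_bigr => i _; rewrite linearZ /= /partial deriveE.
Qed.

(** Injectivity of the differential, read as linear independence of the partials. It allows
    comparing coefficients in the frame, for [f] and for its parallel surface. *)
Lemma immersion_free (R : realType) (U : set 'rV[R]_2)
    (f : 'rV[R]_2 -> 'M[R]_2) (p a : 'rV[R]_2) :
  immersion_on U f -> U p ->
  \sum_(i < 2) a 0 i *: partial i f p = 0 -> a = 0.
Proof.
move=> imm /imm[df inj]; rewrite sum_partial// => da0.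
by apply: inj; rewrite da0 linear0.
Qed.

(** * Shape operators of the surface and of its parallel surface *)

Section parallel_surface.
Context (R : realType) (Omega : set 'rV[R]_2) (f N : 'rV[R]_2 -> 'M[R]_2).
Hypotheses (Omega_open : open Omega).
Hypotheses (f_H31 : forall p, Omega p -> H31 (f p)).
Hypotheses (f_imm : immersion_on Omega f).
Hypotheses (N_diff : forall p, Omega p -> differentiable N p).
Hypotheses (N_normal : unit_normal_on Omega f N).

(** [xget] returns a genuine solution once one exists. The partials of [N] are orthogonal to [f] and
    [N], hence are combinations of those of [f], whose coefficients form the rows of the matrix. *)
Lemma shape_operatorP p : Omega p ->
  is_shape_operator f N p (shape_operator f N p).
Proof.
move=> Op; apply: (@xgetPex _ 0 [set S | is_shape_operator f N p S]) => /=.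
have [NN NF NX] := N_normal _ Op.
have df i : derivable f p (delta_mx 0 i).
  by apply: diff_derivable; have [] := f_imm _ Op.
have dN i : derivable N p (delta_mx 0 i) by exact/diff_derivable/N_diff.
have half_eq0 (x : R) : x + x = 0 -> x = 0.
  by move=> /eqP; rewrite -mulr2n mulrn_eq0 => /eqP.
have fX i : ads_form (f p) (partial i f p) = 0.
  have := derive_ads_form_cst _ _ _ _ _ _ _ _ Omega_open Op f_H31 (df i) (df i).
  by rewrite ads_formC => /half_eq0.
have NY i : ads_form (N p) (partial i N p) = 0.
  have NN1 q : Omega q -> ads_form (N q) (N q) = 1 by move=> /N_normal[].
  have := derive_ads_form_cst _ _ _ _ _ _ _ _ Omega_open Op NN1 (dN i) (dN i).
  by rewrite ads_formC => /half_eq0.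
(* Differentiate [<N,f> = 0]; the other Leibniz term [<N,f_i>] vanishes by normality. *)
have fY i : ads_form (f p) (partial i N p) = 0.
  have NF0 q : Omega q -> ads_form (N q) (f q) = 0 by move=> /N_normal[].
  have := derive_ads_form_cst _ _ _ _ _ _ _ _ Omega_open Op NF0 (dN i) (df i).
  by rewrite [X in _ + X]NX addr0 ads_formC.
have /choice[a aE] : forall i, exists a : 'rV[R]_2,
    \sum_(j < 2) a 0 j *: partial j f p = partial i N p.
  move=> i; apply: (orthogonal_complement_span _ (f p) (N p)) => //.
  - exact: f_H31.
  - by move=> a; exact: immersion_free f_imm Op.
exists (\matrix_i a i) => i; rewrite -aE.
by apply: eq_bigr => j _; rewrite mxE.
Qed.

Lemma parallel_shape_operator (theta : R) (U : set 'rV[R]_2) p :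
  U `<=` Omega -> U p -> immersion_on U (parallel f N theta) ->
  let S := shape_operator f N p in
  shape_operator (parallel f N theta) (parallel_normal f N theta) p
    *m ((cosh theta)%:M + sinh theta *: S) =
  (sinh theta)%:M + cosh theta *: S.
Proof.
move=> UO Up imm S; set c := cosh theta; set s := sinh theta.
have Op := UO _ Up; have SP := shape_operatorP _ Op; rewrite -/S in SP.
have df i : derivable f p (delta_mx 0 i).
  by apply: diff_derivable; have [] := f_imm _ Op.
have dN i : derivable N p (delta_mx 0 i) by exact/diff_derivable/N_diff.
have combE (a b : R) i :
    a *: partial i f p + b *: partial i N p =
    \sum_(j < 2) (a%:M + b *: S) i j *: partial j f p.
  rewrite -SP scaler_sumr.
  transitivity (\sum_(j < 2) (a%:M : 'M[R]_2) i j *: partial j f p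
      + \sum_(j < 2) b *: (S i j *: partial j f p)).
    congr (_ + _); rewrite (bigD1 i)//= mxE eqxx mulr1n big1 ?addr0// => j.
    by rewrite mxE eq_sym => /negPf ->; rewrite mulr0n scale0r.
  by rewrite -big_split; apply: eq_bigr => j _; rewrite [in RHS]mxE scalerDl
    [X in _ = _ + X *: _]mxE scalerA.
have fpE i : partial i (parallel f N theta) p =
    \sum_(j < 2) (c%:M + s *: S) i j *: partial j f p.
  rewrite -combE /partial /parallel deriveD ?deriveZ//; exact: derivableZ.
have NpE i : partial i (parallel_normal f N theta) p =
    \sum_(j < 2) (s%:M + c *: S) i j *: partial j f p.
  rewrite -combE addrC /partial /parallel_normal deriveD ?deriveZ//;
    exact: derivableZ.
have rowE (a : 'rV[R]_2) (M : 'M[R]_2) :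
    \sum_(i < 2) a 0 i *: (\sum_(j < 2) M i j *: partial j f p) =
    \sum_(j < 2) (a *m M) 0 j *: partial j f p.
  under eq_bigr do rewrite scaler_sumr.
  rewrite exchange_big; apply: eq_bigr => j _.
  by rewrite mxE scaler_suml; apply: eq_bigr => i _; rewrite scalerA.
(* A row vector in the left kernel gives a vanishing combination of the partials of the parallel
   surface, so it is zero. *)
have Punit : c%:M + s *: S \in unitmx.
  rewrite -row_free_unit -kermx_eq0; apply/rowV0P => a /sub_kermxP aP.
  apply: (immersion_free _ _ _ _ _ imm Up).
  under eq_bigr do rewrite fpE.
  by rewrite rowE aP big1// => j _; rewrite mxE scale0r.
(* An explicit solution rules out the default value of [xget]. *)
have TP : is_shape_operator (parallel f N theta)
    (parallel_normal f N theta) p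
    (shape_operator (parallel f N theta) (parallel_normal f N theta) p).
  apply: (@xgetPex _ 0 [set T | is_shape_operator _ _ p T]).
  pose T := (s%:M + c *: S) *m invmx (c%:M + s *: S).
  exists T => i /=; under eq_bigr do rewrite fpE.
  transitivity (\sum_(j < 2) (row i T *m (c%:M + s *: S)) 0 j
      *: partial j f p).
    by rewrite -rowE; apply: eq_bigr => j _; rewrite [in RHS]mxE.
  rewrite -row_mul mulmxKV// NpE.
  by apply: eq_bigr => j _; rewrite [X in X *: _]mxE.
(* The [i]-th rows of both sides are coordinates of the same vector, the [i]-th partial of the
   parallel normal, in the frame of [f]. *)
apply/row_matrixP => i; rewrite row_mul; apply/eqP; rewrite -subr_eq0; apply/eqP.
apply: (immersion_free _ _ _ _ _ f_imm Op).
under eq_bigr do rewrite mxE scalerDl [X in _ + X *: _]mxE scaleNr.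
rewrite big_split /= sumrN -rowE.
apply/eqP; rewrite subr_eq0; apply/eqP.
transitivity (partial i (parallel_normal f N theta) p).
  by rewrite -TP; apply: eq_bigr => j _; rewrite mxE fpE.
by rewrite NpE; apply: eq_bigr => j _; rewrite [in RHS]mxE.
Qed.

(** For constant parallel mean curvature [h], the Moebius relation becomes an affine equation [key]
    in [\tr S] with constant coefficients. *)
Lemma mean_curvature_parallel_cst (K theta : R) (U : set 'rV[R]_2) :
  (forall p, Omega p -> gauss_curvature f N p = K) ->
  K * sinh theta ^+ 2 != 1 -> U `<=` Omega ->
  immersion_on U (parallel f N theta) ->
  constant_on U
    (mean_curvature (parallel f N theta) (parallel_normal f N theta)) ->
  constant_on U (mean_curvature f N).
Proof.
move=> f_K Ks UO imm [h hE].
set s := sinh theta in Ks *; pose c := cosh theta.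
have c2 : c ^+ 2 = 1 + s ^+ 2 by exact: cosh_sqr.
have key p : U p ->
    (c ^+ 2 + s ^+ 2 + 2 * h * (c * s)) * \tr (shape_operator f N p) =
    - (2 * h) * (c ^+ 2 + s ^+ 2 * (K + 1)) - 2 * c * s * (K + 2).
  move=> Up; set t := \tr _.
  have dE : \det (shape_operator f N p) = K + 1.
    by rewrite -(f_K p (UO _ Up)) /gauss_curvature subrK.
  have := trace_moebius _ _ _ _ _ (parallel_shape_operator _ _ _ UO Up imm).
  have -> : \tr (shape_operator (parallel f N theta)
      (parallel_normal f N theta) p) = - (2 * h).
    by rewrite -(hE p Up) /mean_curvature; field.
  rewrite dE -/t -/c -/s => E.
  transitivity ((c ^+ 2 + s ^+ 2) * t + 2 * c * s * (1 + (K + 1))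
    + 2 * h * (c * s) * t - 2 * c * s * (K + 2)); first by ring.
  by rewrite -E; ring.
(* A nonzero leading coefficient determines [\tr S]. A zero one means that [- (2 * h)] is the image
   of infinity under the Moebius map, which no finite trace attains. *)
have [m0|m0] := eqVneq (c ^+ 2 + s ^+ 2 + 2 * h * (c * s)) 0; last first.
  exists (- (1 / 2) * ((- (2 * h) * (c ^+ 2 + s ^+ 2 * (K + 1))
    - 2 * c * s * (K + 2)) / (c ^+ 2 + s ^+ 2 + 2 * h * (c * s)))).
  move=> p Up; rewrite /mean_curvature -(key p Up); congr (_ * _).
  by rewrite mulrAC divff// mul1r.
(* The value 0 is arbitrary: any point of [U] now yields a contradiction. *)
exists 0 => p Up; have := key p Up; rewrite m0 mul0r => /esym n0.
(* The determinant of the Moebius transformation lies in the ideal generated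
   by the two coefficients of the affine equation [key] in [tr S]. *)
have : 1 - K * s ^+ 2 =
    (c ^+ 2 + s ^+ 2 + 2 * h * (c * s)) * (c ^+ 2 + s ^+ 2 * (K + 1))
    + (- (2 * h) * (c ^+ 2 + s ^+ 2 * (K + 1)) - 2 * c * s * (K + 2)) * (c * s).
  transitivity ((c ^+ 2 + s ^+ 2) * (c ^+ 2 + s ^+ 2 * (K + 1))
    - 2 * c ^+ 2 * s ^+ 2 * (K + 2)); last by ring.
  by rewrite c2; ring.
rewrite m0 n0 !mul0r addr0 => /eqP; rewrite subr_eq0 eq_sym.
by rewrite (negPf Ks).
Qed.

End parallel_surface.

Theorem proposition5p4 (R : realType) (Omega : set 'rV[R]_2)
  (f N : 'rV[R]_2 -> 'M[R]_2) (K : R)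
  (Omega_open : open Omega) (Omega_connected : connected Omega)
  (f_smooth : smooth_on Omega f) (f_H31 : forall p, Omega p -> H31 (f p))
  (f_timelike : timelike_immersion_on Omega f)
  (N_smooth : smooth_on Omega N) (N_normal : unit_normal_on Omega f N)
  (f_K : forall p, Omega p -> gauss_curvature f N p = K)
  (f_H : forall U : set 'rV[R]_2, open U -> U !=set0 -> U `<=` Omega ->
     ~ constant_on U (mean_curvature f N)) :
  (forall theta : R, theta != 0 -> K * sinh theta ^+ 2 != 1 ->
     forall U : set 'rV[R]_2, open U -> U !=set0 -> U `<=` Omega ->
       immersion_on U (parallel f N theta) ->
       ~ constant_on U
           (mean_curvature (parallel f N theta) (parallel_normal f N theta)))
  /\
  (K <= 0 -> forall theta : R,
     forall U : set 'rV[R]_2, open U -> U !=set0 -> U `<=` Omega ->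
       immersion_on U (parallel f N theta) ->
       ~ constant_on U
           (mean_curvature (parallel f N theta) (parallel_normal f N theta))).
Proof.
have f_imm : immersion_on Omega f by have [] := f_timelike.
have N_diff p : Omega p -> differentiable N p by have [+ _] := N_smooth 1; exact.
(* A constant parallel mean curvature on [U] would make that of [f] constant on [U], which [f_H]
   excludes. *)
have main theta U : K * sinh theta ^+ 2 != 1 -> open U -> U !=set0 ->
    U `<=` Omega -> immersion_on U (parallel f N theta) ->
    ~ constant_on U
        (mean_curvature (parallel f N theta) (parallel_normal f N theta)).
  move=> Ks oU U0 UO imm cst; apply: (f_H U oU U0 UO).
  exact: (mean_curvature_parallel_cst _ Omega _ _ _ _ _ _ _ K theta).
split=> [theta _|K0 theta U]; first by move=> Ks U; exact: main.
apply: main; rewrite lt_eqF// (le_lt_trans _ ltr01)//.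
by rewrite mulr_le0_ge0// sqr_ge0.
Qed.
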